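(* Let $\Bbbk$ be a field, $R=\Bbbk[x_1,\dots,x_n]$, and let $I=\langle m_1,\dots,m_r\rangle\subseteq R$ be a monomial ideal given by an ordered list of monomial generators. Let $\mathcal{A}_S$ be the output of the simplicial pruning algorithm (described in the context). Then each step of that algorithm produces a homogeneous acyclic matching on $X_{\mathrm{Taylor}}$, and the free resolution $\mathbb{F}_\bullet^{(X_{\mathcal{A}_S},gr)}$ is a simplicial free resolution of $R/I$; that is, the faces of $X_{\mathrm{Taylor}}$ not contained in any edge of $\mathcal{A}_S$ form a simplicial complex $X_{\mathcal{A}_S}$, which with its grading supports a free resolution of $R/I$.
   Context: Taylor complex. For $\sigma\in\{0,1\}^r$ put $m_\sigma=\mathrm{lcm}(m_i\mid \sigma_i=1)$, and let $\varepsilon_1,\dots,\varepsilon_r$ be the standard basis of $\mathbb{Z}^r$. $X_{\mathrm{Taylor}}$ is the full simplex on $r$ vertices; its faces are labelled by $\sigma\in\{0,1\}^r$ (the face $\{i\mid\sigma_i=1\}$), partially ordered by inclusion, and it is $\mathbb{Z}^n$-graded by $gr(\sigma)=\alpha$, where $\mathbf{x}^\alpha=m_\sigma$. $E_{X_{\mathrm{Taylor}}}$ is the set of directed edges $\sigma\to\sigma'$ with $\sigma'\le\sigma$ and $\dim\sigma'=\dim\sigma-1$. Simplicial pruning algorithm. For $j=1,\dots,r$ in this order, step $(j)$: for all $\sigma\in\{0,1\}^r$ with $\sigma_j=0$, prune the edge $\sigma+\varepsilon_j\to\sigma$ if it survived after step $(j-1)$, $gr(\sigma)=gr(\sigma+\varepsilon_j)$,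 and no face $\tau>\sigma$ survives at this step $(j)$. The last condition means that every face $\tau>\sigma$ other than $\sigma+\varepsilon_j$ has been removed in an earlier step or is itself removed in step $(j)$; thus within step $(j)$ the candidates $\sigma$ are decided in order of decreasing dimension. Pruning an edge means removing it together with its two vertices and all edges passing through these two vertices. The output $\mathcal{A}_S$ is the set of all pruned edges. Matchings. A set $\mathcal{A}\subseteq E_{X_{\mathrm{Taylor}}}$ is a matching if each face occurs in at most one edge of $\mathcal{A}$; it is acyclic if reversing the direction of the edges in $\mathcal{A}$ gives a directed graph with no directed cycle; it is homogeneous if $gr(\sigma)=gr(\sigma')$ for each $\sigma\to\sigma'\in\mathcal{A}$. Simplicial resolution. A $\mathbb{Z}^n$-graded simplicial complex $(X,gr)$ supports a (simplicial) free resolution $\mathbb{F}_\bullet^{(X,gr)}$ of $R/I$ if the complex with $F_0=R$, with $F_i$ ($i\ge1$) free on basis elements $e_\sigma$ of degree $gr(\sigma)$ indexed by the $(i-1)$-dimensional faces $\sigma$ of $X$, and with differential $e_\sigma\mapsto\sum_{\sigma'}[\sigma:\sigma']\,\mathbf{x}^{gr(\sigma)-gr(\sigma')}e_{\sigma'}$ (sum over the codimension-one faces $\sigma'$ of $\sigma$, $[\sigma:\sigma']=\pm1$ the simplicial boundary coefficients, the empty face having degree $0$ and corresponding to the basis element of $F_0$), is a free resolution of $R/I$.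
   Formalization: F_0 is taken free on the empty face, so F_0 = R unless the pruned complex is void, where F_0 = 0; with F_0 = R the claim fails there, e.g. for r = 1, m_1 = 1, where the algorithm removes every face but R/I = 0. *)

(* Defs.v *)
From mathcomp Require Import all_boot all_algebra.
From mathcomp Require Import mpoly.

Set Implicit Arguments.
Unset Strict Implicit.
Unset Printing Implicit Defensive.

Import GRing.Theory.
Local Open Scope ring_scope.

(* A vector sigma in {0,1}^r is encoded by the set of i with sigma_i = 1; the
   empty set is the empty face, and a face of cardinality d has dimension d-1. *)
Definition face (r : nat) := {set 'I_r}.

(* The directed edge tau -> sigma is the pair (tau, sigma). *)
Definition edge (r : nat) := (face r * face r)%type.

Definition gr_lcm (n r : nat) (m : 'I_r -> 'X_{1..n}) (s : face r) : 'X_{1..n} :=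
  \big[@mlcm n/0%MM]_(i in s) m i.

Definition taylor_edges (r : nat) : {set edge r} :=
  [set e : edge r | (e.2 \subset e.1) && (#|e.1| == #|e.2|.+1)].

Definition incident (r : nat) (s : face r) (e : edge r) : bool :=
  (s == e.1) || (s == e.2).

(* The faces not contained in any edge of A. When A is the set of edges pruned
   so far, these are the surviving faces, and a Taylor edge survives exactly
   when both of its vertices do. *)
Definition critical_faces (r : nat) (A : {set edge r}) : {set face r} :=
  [set s : face r | [forall e in A, ~~ incident s e]].

Section Matchings.

Variables (n r : nat) (gr : face r -> 'X_{1..n}).

Definition matching (A : {set edge r}) : Prop :=
  A \subset taylor_edges r /\
  forall (e1 e2 : edge r) (s : face r), e1 \in A -> e2 \in A ->
    incident s e1 -> incident s e2 -> e1 = e2.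

Definition reversed_graph (A : {set edge r}) : rel (face r) :=
  fun s t => ((s, t) \in taylor_edges r :\: A) || ((t, s) \in A).

Definition acyclic (A : {set edge r}) : Prop :=
  forall c : seq (face r), c != [::] -> ~~ cycle (reversed_graph A) c.

Definition homogeneous (A : {set edge r}) : Prop :=
  forall e : edge r, e \in A -> gr e.1 = gr e.2.

Definition homogeneous_acyclic_matching (A : {set edge r}) : Prop :=
  [/\ matching A, acyclic A & homogeneous A].

End Matchings.

Section SimplicialPruning.

Variables (n r : nat) (gr : face r -> 'X_{1..n}).

(* A is the set of edges pruned before step j and B the set of edges already
   pruned during step j, at candidates of larger dimension. *)
Definition prunable (j : 'I_r) (A B : {set edge r}) (s : face r) : bool :=
  [&& j \notin s,
      j |: s \in critical_faces A,
      s \in critical_faces A,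
      gr s == gr (j |: s)
    & [forall t : face r,
        (s \proper t) && (t != j |: s) ==> (t \notin critical_faces (A :|: B))]].

(* Candidates of equal cardinality do not influence each other: sigma and
   sigma' both avoid j, so sigma is a face of sigma' + epsilon_j only if
   sigma = sigma'. They are therefore decided simultaneously. *)
Definition prune_dim (j : 'I_r) (A B : {set edge r}) (d : nat) : {set edge r} :=
  B :|: [set (j |: s, s) | s : face r & (#|s| == d) && prunable j A B s].

(* The set of edges pruned in step j; cardinalities run through r-1, ..., 0. *)
Definition prune_step (A : {set edge r}) (j : 'I_r) : {set edge r} :=
  foldl (prune_dim j A) set0 (rev (iota 0 r)).

(* The set of edges pruned in the first k steps. *)
Definition pruned_upto (k : nat) : {set edge r} :=
  foldl (fun A j => A :|: prune_step A j) set0 (take k (enum 'I_r)).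

Definition simplicial_pruning : {set edge r} := pruned_upto r.

End SimplicialPruning.

(* The void complex, without even the empty face, is allowed: it can be the output
   of the pruning algorithm when some generator is 1. *)
Definition simplicial_complex (r : nat) (X : {set face r}) : Prop :=
  forall s t : face r, s \in X -> t \subset s -> t \in X.

Section SimplicialResolution.

Variables (K : fieldType) (n r : nat).
Variables (X : {set face r}) (gr : face r -> 'X_{1..n}).

Local Notation R := {mpoly K[n]}.

Definition faces_of_card (i : nat) := {s : face r | (s \in X) && (#|s| == i)}.

(* F_i, free on the faces of dimension i-1. In particular F_0 has the single
   basis element e_emptyset, that is F_0 = R, as soon as X is not void; it is
   zero for the void complex. *)
Definition chains (i : nat) := {ffun faces_of_card i -> R}.

(* [sigma : sigma'], which is zero unless sigma' is a facet of sigma. *)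
Definition incidence (s t : face r) : R :=
  \sum_(v in s | t == s :\ v) (-1) ^+ #|[set u in s | (u < v)%N]|.

Definition differential (i : nat) (c : chains i.+1) : chains i :=
  [ffun t => \sum_(s : faces_of_card i.+1)
     c s * (incidence (val s) (val t) * 'X_[(gr (val s) - gr (val t))%MM])].

(* The lift F_0 -> R, e_emptyset |-> 1, of the augmentation F_0 -> R/I. *)
Definition augmentation (c : chains 0) : R := \sum_(s : faces_of_card 0) c s.

Definition monomial_ideal (m : 'I_r -> 'X_{1..n}) (p : R) : Prop :=
  exists c : 'I_r -> R, p = \sum_(i < r) c i * 'X_[m i].

(* Exactness of ... -> F_2 -> F_1 -> F_0 -> R/I -> 0, at the F_i with i > 0,
   at F_0 and at R/I respectively. *)
Definition supports_free_resolution (m : 'I_r -> 'X_{1..n}) : Prop :=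
  [/\ forall (i : nat) (c : chains i.+1),
        differential c = 0 <-> exists b : chains i.+2, differential b = c,
      forall c : chains 0,
        monomial_ideal m (augmentation c) <->
        exists b : chains 1, differential b = c
    & forall p : R, exists c : chains 0, monomial_ideal m (p - augmentation c)].

End SimplicialResolution.

(* Main.v *)
Require Import Defs.
From HB Require Import structures.
From mathcomp Require Import all_boot all_algebra.
From mathcomp Require Import mpoly.

Set Implicit Arguments.
Unset Strict Implicit.
Unset Printing Implicit Defensive.

Import GRing.Theory.
Local Open Scope ring_scope.

(** The algorithm only performs elementary collapses: when the edge from
    j |: s to s is pruned, j |: s is the only other surviving face that contains
    s, and both have the same degree. Hence the output is reached from the full
    simplex by a sequence of homogeneous elementary collapses
    (collapsed_pruned_upto), and everything follows from properties of such
    sequences.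

    The surviving faces form a simplicial complex at every moment
    (collapsed_complex). The pruned edges form a matching, and any subset of them
    is acyclic, because the time at which a face is removed is monotone along
    the graph with reversed edges (collapsed_rank, collapsed_sub).

    For the resolution, the Taylor complex is exact because in each multidegree
    a it is the augmented chain complex of a simplex, on the generators that
    divide x^a, and can be contracted onto a vertex (taylor_exact). Exactness
    survives each collapse (exact_collapse): in the quotient, spanned by the
    two faces removed, the differential is multiplication by a unit, since their degrees
    agree. The Taylor resolution thus restricts to an exact complex on the
    surviving faces. If the empty face has been pruned, some generator
    is 1, and the zero complex resolves R/I = 0. *)

(** * Elementary collapses *)

Lemma criticalP r (A : {set edge r}) s :
  reflect (forall e, e \in A -> ~~ incident s e) (s \in critical_faces A).
Proof. by rewrite inE; apply: forall_inP. Qed.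

Lemma criticalU r (A B : {set edge r}) s :
  (s \in critical_faces (A :|: B)) =
  (s \in critical_faces A) && (s \in critical_faces B).
Proof.
apply/criticalP/andP=> [cAB | [/criticalP cA /criticalP cB] e].
  by split; apply/criticalP=> e eA; apply: cAB; rewrite inE eA ?orbT.
by rewrite inE => /orP[/cA|/cB].
Qed.

Lemma critical1 r (e : edge r) s :
  (s \in critical_faces [set e]) = (s != e.1) && (s != e.2).
Proof.
rewrite -negb_or; apply/criticalP/idP=> [/(_ e (set11 e))//|h e'].
by rewrite inE => /eqP->.
Qed.

Lemma critical0 r (s : face r) : s \in critical_faces set0.
Proof. by apply/criticalP=> e; rewrite inE. Qed.

Lemma critical_sub r (A' A : {set edge r}) s : A' \subset A -> s \in critical_faces A ->
  s \in critical_faces A'.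
Proof.
by move=> /subsetP sub /criticalP sA; apply/criticalP=> e /sub; apply: sA.
Qed.

Lemma card_face r (s : face r) : (#|s| <= r)%N.
Proof. by rewrite -[X in (_ <= X)%N](card_ord r) max_card. Qed.

(** Along a directed cycle the potential would be smaller than itself. *)
Lemma acyclic_potential r (A : {set edge r}) (P : face r -> nat) :
  (forall s t, reversed_graph A s t -> P s < P t)%N -> acyclic A.
Proof.
move=> incr [//|x p] _; apply/negP=> /= cyc.
have : path [rel s t | (P s < P t)%N] x (rcons p x).
  by apply: sub_path cyc => s t; apply: incr.
move=> /order_path_min => /(_ (fun _ _ _ => @ltn_trans _ _ _))/allP/(_ x).
by rewrite mem_rcons mem_head /= ltnn => /(_ isT).
Qed.

Section Collapses.
Variables (n r : nat) (gr : face r -> 'X_{1..n}).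
Implicit Types (A B : {set edge r}) (s t : face r).

(** The sets of edges obtained from the full simplex by successive homogeneous
    elementary collapses: each new edge removes a face s together with the only
    other surviving face v |: s that contains it. *)
Inductive collapsed : {set edge r} -> Prop :=
| Collapsed0 : collapsed set0
| CollapsedU A v s of collapsed A & v \notin s
    & v |: s \in critical_faces A & s \in critical_faces A
    & gr s = gr (v |: s)
    & (forall t, t \in critical_faces A -> s \subset t ->
         t = s \/ t = v |: s) :
    collapsed ((v |: s, s) |: A).

Lemma critical_collapse A v s t :
  (t \in critical_faces ((v |: s, s) |: A)) =
  [&& t != v |: s, t != s & t \in critical_faces A].
Proof. by rewrite criticalU critical1 andbA. Qed.

(** A face that contains s or v |: s contains s, hence is one of these two.
    Removing both therefore keeps the set of surviving faces closed under
    inclusion. *)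
Lemma collapsed_complex A : collapsed A -> simplicial_complex (critical_faces A).
Proof.
elim=> [s t _ _|{}A v s cA IH vs tA sA grs free t u]; first exact: critical0.
rewrite !critical_collapse => /and3P[tvs ts tcA] ut.
have uA := IH _ _ tcA ut; rewrite uA andbT; apply/andP; split.
  apply: contra_neq tvs => uvs; subst u.
  have sub : s \subset t by apply: subset_trans ut; apply: subsetUr.
  by case: (free _ tcA sub) => // ets; rewrite ets eqxx in ts.
apply: contra_neq ts => us; subst u.
by case: (free _ tcA ut) => // ets; rewrite ets eqxx in tvs.
Qed.

Lemma collapsed_homogeneous A : collapsed A -> homogeneous gr A.
Proof.
elim=> [e|{}A v s cA IH vs tA sA grs free e]; first by rewrite inE.
by rewrite !inE => /orP[/eqP->|/IH].
Qed.

Lemma collapsed_matching A : collapsed A -> matching A.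
Proof.
elim=> [|{}A v s cA [subA mA] vs tA sA grs free].
  by split=> [|e1 e2 s]; rewrite ?sub0set ?inE.
split=> [|e1 e2 t].
  by rewrite subUset subA sub1set !inE /= subsetUr cardsU1 vs eqxx.
have new e : e \in A -> incident t e -> incident t (v |: s, s) -> False.
  move=> eA te /orP[]/= /eqP ett; subst t;
  [move/criticalP: tA|move/criticalP: sA] => /(_ _ eA); by rewrite te.
rewrite !inE => /orP[/eqP->|e1A] /orP[/eqP->|e2A] t1 t2 //.
- by case: (new _ e2A t2 t1).
- by case: (new _ e1A t1 t2).
exact: mA t1 t2.
Qed.

(** The rank of a face is the time at which it is removed, and is maximal exactly
    for the faces that survive. Survivors form a complex at all times, so that the
    rank does not decrease from a face to its subsets; one collapse removes just
    one edge, so that distinct nested faces have equal rank only if they form an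
    edge of A or both survive. This is stronger
    than acyclicity of A, and yields it for every subset of A. *)
Lemma collapsed_rank A : collapsed A ->
  exists rank : face r -> nat,
    (forall s t, t \subset s -> rank s <= rank t)%N /\
    [/\ forall e, e \in A -> rank e.1 = rank e.2,
        forall s t, t \proper s -> rank s = rank t ->
          (s, t) \in A \/ s \in critical_faces A /\ t \in critical_faces A
      & exists k, forall s, (rank s <= k)%N /\
                            (rank s == k) = (s \in critical_faces A)].
Proof.
elim=> [|{}A v s cA [rank [mono [eqA strict [k rk]]]] vs tA sA grs free].
  exists (fun=> 0); split=> //; split=> [//|s t _ _|].
    by right; rewrite !critical0.
  by exists 0 => s; rewrite critical0.
set A' := _ |: A.
have cA' : collapsed A' by apply: CollapsedU.
exists (fun t => if t \in critical_faces A' then k.+1 else rank t).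
have rk' u : (rank u < k.+1)%N by rewrite ltnS; case: (rk u).
split; [|split].
- move=> u t tu; case: ifPn => [uc|unc].
    by rewrite (collapsed_complex cA' uc tu).
  by case: ifP => _; [apply: ltnW; apply: rk'|apply: mono].
- move=> e eA'; rewrite !ifF.
  + move: eA'; rewrite inE => /orP[|/eqA//]; rewrite inE => /eqP-> /=.
    case: (rk (v |: s)) => _; rewrite tA => /eqP->.
    by case: (rk s) => _; rewrite sA => /eqP->.
  + by apply/negP=> /criticalP/(_ _ eA'); rewrite /incident eqxx orbT.
  + by apply/negP=> /criticalP/(_ _ eA'); rewrite /incident eqxx.
- move=> u t tu; case: ifPn => uc; case: ifPn => tc ruv.
  + by right.
  + by have := rk' t; rewrite -ruv ltnn.
  + by have := rk' u; rewrite ruv ltnn.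
  left; case: (strict _ _ tu ruv) => [utA|[uA tAc]]; first by rewrite inE utA orbT.
  move: uc tc; rewrite !critical_collapse uA tAc !andbT !negb_and !negbK.
  move=> /orP[]/eqP eu /orP[]/eqP et; subst u t; rewrite ?properxx // in tu *.
    by rewrite !inE eqxx.
  by have := proper_sub tu; rewrite subUset sub1set (negPf vs).
exists k.+1 => u; case: ifPn => uc; first by rewrite leqnn eqxx.
by rewrite ltnW ?rk' // ltn_eqF ?rk'.
Qed.

(** Reversed edges keep the rank, the other edges do not decrease it. The second
    component of a lexicographic potential breaks ties: the cardinality for the
    faces matched by A', which is increased by a reversed edge, and the
    codimension for the others, which is increased by an ordinary edge. A single
    step of the algorithm is such a subset A' of a sequence of collapses. *)
Lemma collapsed_sub A' A : collapsed A -> A' \subset A ->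
  homogeneous_acyclic_matching gr A'.
Proof.
move=> cA sub; have [subT mA] := collapsed_matching cA; split.
- split=> [|e1 e2 s e1A' e2A']; first exact: subset_trans subT.
  by apply: mA; apply: (subsetP sub).
- have [rank [mono [eqA strict _]]] := collapsed_rank cA.
  (* Both components are at most r, hence the factor r.+1 below. *)
  pose low s := if s \in critical_faces A' then (r - #|s|)%N else #|s|.
  have lowr s : (low s < r.+1)%N.
    by rewrite /low ltnS; case: ifP => _; rewrite ?leq_subr ?card_face.
  have lex s t : (rank s <= rank t)%N -> (rank s = rank t -> low s < low t)%N ->
    (rank s * r.+1 + low s < rank t * r.+1 + low t)%N.
    rewrite leq_eqVlt => /orP[/eqP-> /(_ erefl)|rst _]; first by rewrite ltn_add2l.
    apply: (@leq_trans (rank s * r.+1 + r.+1)); first by rewrite ltn_add2l.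
    by rewrite -mulSnr (leq_trans _ (leq_addr _ _)) // leq_mul2r rst orbT.
  apply: (@acyclic_potential _ _ (fun s => (rank s * r.+1 + low s)%N)) => s t /orP[].
    rewrite !inE /= => /and3P[stA' ts /eqP cst]; apply: lex; first exact: mono.
    move=> rst.
    have pts : t \proper s by rewrite properEcard ts cst ltnSn.
    (* An edge of A outside A' has no endpoint in A', as A is a matching. *)
    have [sA' tA'] : s \in critical_faces A' /\ t \in critical_faces A'.
      case: (strict _ _ pts rst) => [stA|[sA tA]]; last first.
        by split; apply: critical_sub sub _.
      split; apply/criticalP=> e eA'; apply/negP=> ie; case/negP: stA';
      rewrite (_ : (s, t) = e) //; apply: mA stA (subsetP sub _ eA') _ ie;
      by rewrite /incident eqxx ?orbT.
    rewrite /low sA' tA' cst; apply: ltn_sub2l => //.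
    by rewrite -cst card_face.
  move=> tsA'; have tsA := subsetP sub _ tsA'.
  have /= rst := eqA _ tsA; apply: lex; rewrite rst // => _.
  have := subsetP subT _ tsA; rewrite inE /= => /andP[_ /eqP cts].
  rewrite /low !ifF ?cts //; apply/negP=> /criticalP/(_ _ tsA');
  by rewrite /incident eqxx ?orbT.
move=> e /(subsetP sub); exact: collapsed_homogeneous.
Qed.

End Collapses.

(** * The pruning algorithm performs collapses *)

Section Pruning.
Variables (n r : nat) (gr : face r -> 'X_{1..n}).
Implicit Types (A B : {set edge r}) (s t : face r) (j : 'I_r).

Lemma setU1_inj_notin j s t : j \notin s -> j \notin t -> j |: s = j |: t -> s = t.
Proof.
by move=> js jt /(congr1 (fun u => u :\ j)); rewrite !setU1K.
Qed.

(** What holds of the edges already pruned in step j once the candidates of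
    cardinality at least d have been decided. *)
Definition step_edges j (d : nat) B :=
  forall e, e \in B -> [/\ j \notin e.2, e.1 = j |: e.2 & (d <= #|e.2|)%N].

(** The prunable candidates of one cardinality are added one at a time. The test
    of the algorithm sees only the edges A :|: B; it still guarantees a free face
    once some candidates of the same cardinality are gone, because removing
    faces only helps, and their edges meet neither s nor j |: s. *)
Lemma collapsed_prune_dim j A B d :
  step_edges j d.+1 B -> collapsed gr (A :|: B) ->
  collapsed gr (A :|: prune_dim gr j A B d).
Proof.
move=> stepB cAB.
set Q := [set s : face r | (#|s| == d) && prunable gr j A B s].
have edges l : uniq l -> all (fun s => s \in Q) l ->
    collapsed gr ((A :|: B) :|: [set e in [seq (j |: s, s) | s <- l]]).
  elim: l => [_ _|s l IH /= /andP[sl ul] /andP[]].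
    by rewrite (_ : [set e in _] = set0) ?setU0 //; apply/setP=> e; rewrite !inE.
  rewrite inE => /andP[/eqP cs ps] Ql; have {IH} cl := IH ul Ql; have Ql' := allP Ql.
  rewrite (_ : _ :|: _ =
    (j |: s, s) |: (A :|: B :|: [set e in [seq (j |: s, s) | s <- l]])); last first.
    by apply/setP=> e; rewrite !inE orbCA.
  case/and5P: (ps) => js tA sA /eqP grs /forallP free.
  (* The two vertices of the new edge are still present. *)
  have stay t : t = s \/ t = j |: s -> t \in critical_faces A ->
      t \in critical_faces (A :|: B :|: [set e in [seq (j |: s, s) | s <- l]]).
    move=> ets tAc; apply/criticalP=> e; rewrite inE => /orP[]; last first.
      rewrite inE => /mapP[u ul' ->].
      have := Ql' _ ul'; rewrite /= inE => /andP[/eqP cu /and5P[ju _ _ _ _]].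
      have su : s != u by apply: contraNneq sl => ->.
      rewrite /incident /=; case: ets => ->; rewrite negb_or; apply/andP; split=> //.
      - by apply: contraNneq js => ->; rewrite setU11.
      - by apply: contra_neq su; apply: setU1_inj_notin.
      - by apply: contraNneq ju => <-; rewrite setU11.
    rewrite inE => /orP[eA|eB]; first by move/criticalP: tAc; apply.
    have [je e1 de] := stepB _ eB; rewrite /incident e1.
    have se : s != e.2 by apply: contraTneq de => <-; rewrite cs -ltnNge.
    case: ets => ->; rewrite negb_or; apply/andP; split=> //.
    - by apply: contraNneq js => ->; rewrite setU11.
    - by apply: contra_neq se; apply: setU1_inj_notin.
    - by apply: contraNneq je => <-; rewrite setU11.
  apply: CollapsedU => //; [exact: stay (or_intror _) _|exact: stay (or_introl _) _|].
  move=> t; rewrite criticalU => /andP[tc _] st.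
  have [->|ts] := eqVneq t s; first by left.
  have [->|tjs] := eqVneq t (j |: s); first by right.
  by have := free t; rewrite tjs properEneq eq_sym ts st tc.
have defB : [set e in [seq (j |: s, s) | s <- enum Q]] = [set (j |: s, s) | s in Q].
  apply/setP=> e; rewrite inE.
  apply/mapP/imsetP=> [[s]|[s]] Qs ->; exists s => //; move: Qs; by rewrite mem_enum.
have allQ : all (fun s => s \in Q) (enum Q) by apply/allP=> s; rewrite mem_enum.
by have := edges _ (enum_uniq _) allQ; rewrite defB -setUA.
Qed.

Lemma collapsed_prune_step A j :
  collapsed gr A -> collapsed gr (A :|: prune_step gr A j).
Proof.
move=> cA; suff main d : (d <= r)%N ->
    let B := foldl (prune_dim gr j A) set0 (rev (iota d (r - d))) in
    step_edges j d B /\ collapsed gr (A :|: B).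
  by have [_] := main 0%N isT; rewrite subn0.
move=> dr; rewrite -(subKn dr); elim: (r - d)%N (leq_subr d r) => [_|k IH kr].
  rewrite subn0 subnn /=; split; last by rewrite setU0.
  by move=> e; rewrite inE.
have [] := IH (ltnW kr); rewrite !subKn ?(ltnW kr) //.
have -> : rev (iota (r - k.+1) k.+1) = rcons (rev (iota (r - k) k)) (r - k.+1)%N.
  by rewrite /= rev_cons subnSK.
rewrite foldl_rcons; set B := foldl _ _ _ => stepB cAB.
have stepB' : step_edges j (r - k.+1).+1 B by rewrite subnSK.
split; last exact: collapsed_prune_dim.
move=> e; rewrite inE => /orP[/stepB'[je e1 de]|/imsetP[s]].
  by split=> //; apply: ltnW.
by rewrite inE => /andP[/eqP cs /and5P[js _ _ _ _]] -> /=; rewrite cs.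
Qed.

Lemma pruned_uptoS j :
  pruned_upto gr j.+1 = pruned_upto gr j :|: prune_step gr (pruned_upto gr j) j.
Proof.
rewrite /pruned_upto (take_nth j) ?size_enum_ord // nth_ord_enum -cats1.
by rewrite foldl_cat.
Qed.

Lemma collapsed_pruned_upto k : collapsed gr (pruned_upto gr k).
Proof.
rewrite /pruned_upto; elim/last_ind: (take k _) => [|l j IH]; first exact: Collapsed0.
rewrite foldl_rcons; exact: collapsed_prune_step.
Qed.

End Pruning.

(** * Signs of the simplicial boundary *)

Section Signs.
Variables (K : fieldType) (r : nat).
Implicit Types (s : face r) (u v : 'I_r).

Definition below s v := #|[set u in s | (u < v)%N]|.

Definition sgn s v : K := (-1) ^+ below s v.

Lemma sgn2 s v : sgn s v * sgn s v = 1.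
Proof. by rewrite -expr2 sqrr_sign. Qed.

Lemma below_rem s u v : v \in s -> below s u = ((v < u)%N + below (s :\ v) u)%N.
Proof.
move=> vs; rewrite /below (cardsD1 v) inE vs /=; congr (_ + _)%N.
by apply: eq_card => w; rewrite !inE andbA.
Qed.

(** Exactly one of the two counts drops when the other vertex is deleted, namely
    that of the larger vertex. *)
Lemma sgn_swap s u v : u \in s -> v \in s -> u != v ->
  sgn (s :\ v) u * sgn (s :\ u) v = - (sgn s v * sgn s u).
Proof.
wlog uv : u v / (u < v)%N => [th us vs nuv|us vs _].
  have [uv|vu|/val_inj uv] := ltngtP u v; first exact: th.
    by rewrite mulrC th 1?eq_sym // mulrC.
  by rewrite uv eqxx in nuv.
rewrite /sgn (below_rem v us) (below_rem u vs) uv ltnNge ltnW //= add0n add1n.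
by rewrite exprS mulN1r mulNr opprK mulrC.
Qed.

Lemma sgn_anti s u v : u \in s -> v \in s -> u != v ->
  sgn s v * sgn (s :\ v) u = - (sgn s u * sgn (s :\ u) v).
Proof.
move=> us vs uv; have := sgn_swap us vs uv.
move=> /(congr1 (fun x => x * (sgn s v * sgn (s :\ u) v))).
rewrite mulrACA sgn2 mulr1 mulrC => ->.
by rewrite mulNr mulrACA sgn2 mul1r.
Qed.

End Signs.

(** * The Taylor complex *)

Section Lift.
Variables (K : fieldType) (n : nat) (V : lmodType K) (f : 'X_{1..n} -> V).

(** The K-linear extension of a function given on the monomials. *)
Definition mlift (p : {mpoly K[n]}) : V := \sum_(a <- msupp p) p@_a *: f a.

(** Over a range of monomials that does not depend on p, the sum is visibly
    linear in p. *)
Lemma mliftwE k p : (msize p <= k)%N ->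
  mlift p = \sum_(a : 'X_{1..n < k}) p@_a *: f a.
Proof.
move=> pk; pose I : subFinType _ := 'X_{1..n < k}.
rewrite /mlift (ssrcomplements.big_mksub I) //=; first last.
- by move=> a /msize_mdeg_lt /leq_trans; apply.
- exact: msupp_uniq.
by rewrite big_rmcond //= => a /memN_msupp_eq0 ->; rewrite scale0r.
Qed.

Lemma mlift_is_linear : linear mlift.
Proof.
move=> x p q; set k := maxn (maxn (msize p) (msize q)) (msize (x *: p + q)).
have pk : (msize p <= k)%N by rewrite !leq_max leqnn.
have qk : (msize q <= k)%N by rewrite !leq_max leqnn orbT.
have xk : (msize (x *: p + q) <= k)%N by rewrite !leq_max leqnn orbT.
rewrite (mliftwE pk) (mliftwE qk) (mliftwE xk) scaler_sumr -big_split /=.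
by apply: eq_bigr => a _; rewrite mcoeffD mcoeffZ scalerDl scalerA.
Qed.

Lemma mliftX a : mlift 'X_[a] = f a.
Proof. by rewrite /mlift msuppX big_seq1 mcoeffX eqxx scale1r. Qed.

HB.instance Definition _ :=
  GRing.isLinear.Build K {mpoly K[n]} V _ mlift mlift_is_linear.
End Lift.

Lemma lem_gr_lcm n r (m : 'I_r -> 'X_{1..n}) (s : face r) a :
  (gr_lcm m s <= a)%MM = [forall i in s, (m i <= a)%MM].
Proof.
rewrite /gr_lcm.
rewrite (big_morph (fun x => (x <= a)%MM) (@lem_mlcm n a) (id1 := true)).
  by rewrite big_andE.
by apply/mnm_lepP=> i; rewrite mnm0E.
Qed.

Lemma le_gr_lcm n r (m : 'I_r -> 'X_{1..n}) (s : face r) i :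
  i \in s -> (m i <= gr_lcm m s)%MM.
Proof.
move=> si; have := lepm_refl (gr_lcm m s).
by rewrite {1}lem_gr_lcm => /forall_inP; apply.
Qed.

Lemma gr_lcm_sub n r (m : 'I_r -> 'X_{1..n}) (t s : face r) :
  t \subset s -> (gr_lcm m t <= gr_lcm m s)%MM.
Proof.
move=> /subsetP ts; rewrite lem_gr_lcm; apply/forall_inP=> i /ts.
exact: le_gr_lcm.
Qed.

Lemma gr_lcm0 n r (m : 'I_r -> 'X_{1..n}) : gr_lcm m set0 = 0%MM.
Proof. by rewrite /gr_lcm big_set0. Qed.

Lemma gr_lcm1 n r (m : 'I_r -> 'X_{1..n}) i : gr_lcm m [set i] = m i.
Proof. by rewrite /gr_lcm big_set1E /= mlcm0. Qed.

Section Taylor.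
Variables (K : fieldType) (n r : nat) (m : 'I_r -> 'X_{1..n}).
Local Notation gr := (gr_lcm m).
Local Notation R := {mpoly K[n]}.
Local Notation chain := {ffun face r -> R}.
Local Notation sgn := (@sgn K r).
Implicit Types (c b : chain) (s t : face r) (p q : R) (a : 'X_{1..n}).

(** The differential of the whole Taylor complex, with chains of all dimensions
    taken together. Chains on a smaller set of faces are those that vanish
    outside it. *)
Definition bd c : chain :=
  [ffun t => \sum_s c s * (incidence K n s t * 'X_[(gr s - gr t)%MM])].

Lemma bd_is_linear : linear bd.
Proof.
move=> x c b; apply/ffunP=> t; rewrite !ffunE scaler_sumr -big_split /=.
by apply: eq_bigr => s _; rewrite !ffunE mulrDl scalerAl.
Qed.
HB.instance Definition _ := GRing.isLinear.Build K chain chain _ bd bd_is_linear.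

Definition single s p : chain := [ffun t => if t == s then p else 0].

Lemma single_is_linear s : linear (single s).
Proof.
by move=> x p q; apply/ffunP=> t; rewrite !ffunE; case: eqP; rewrite ?scaler0 ?addr0.
Qed.
HB.instance Definition _ s :=
  GRing.isLinear.Build K R chain _ (single s) (@single_is_linear s).

Lemma chain_single c : c = \sum_s single s (c s).
Proof.
apply/ffunP=> t; rewrite sum_ffunE (bigD1 t) //= ffunE eqxx big1 ?addr0 // => s st.
by rewrite ffunE eq_sym (negPf st).
Qed.

Lemma sgnE s (v : 'I_r) p : p * (-1) ^+ #|[set u in s | (u < v)%N]| = sgn s v *: p.
Proof. by rewrite mulrC -mul_mpolyC rmorphXn rmorphN1. Qed.

(** Read through the cofaces of t, a coefficient of a boundary is seen to vanish
    or to reduce to one term from the support of the chain alone. *)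
Lemma bdE c t : bd c t =
  \sum_(u | u \notin t) sgn (u |: t) u *: (c (u |: t) * 'X_[(gr (u |: t) - gr t)%MM]).
Proof.
rewrite ffunE.
under eq_bigr => s _ do rewrite /incidence big_mkcond mulr_suml mulr_sumr.
rewrite exchange_big [RHS]big_mkcond; apply: eq_bigr => u _ /=.
have condE s : (u \in s) && (t == s :\ u) = (s == u |: t) && (u \notin t).
  apply/andP/andP=> [[us /eqP->]|[/eqP-> ut]].
    by rewrite setD1K // !inE !eqxx.
  by rewrite setU11 setU1K.
case: ifP => ut.
  rewrite (bigD1 (u |: t)) //= condE eqxx ut /= big1 ?addr0.
    by rewrite -sgnE mulrCA mulrC.
  by move=> s sn; rewrite condE (negPf sn) /= mul0r mulr0.
by rewrite big1 // => s _; rewrite condE ut andbF mul0r mulr0.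
Qed.

Lemma bd_single s p : bd (single s p) =
  \sum_(v in s) sgn s v *: single (s :\ v) (p * 'X_[(gr s - gr (s :\ v))%MM]).
Proof.
apply/ffunP=> t; rewrite bdE sum_ffunE big_mkcond [RHS]big_mkcond.
apply: eq_bigr => u _; rewrite !ffunE.
have [ut|ut] /= := boolP (u \in t).
  case: ifP => // us; rewrite ifF ?scaler0 //.
  by apply: contraTF ut => /eqP->; rewrite !inE eqxx.
case: ifP => [/eqP<-|us]; first by rewrite setU11 setU1K // eqxx.
rewrite mul0r scaler0; case: ifP => // us'; rewrite ifF ?scaler0 //.
by apply: contraFF us => /eqP->; rewrite setD1K.
Qed.

(** The multiple p of the basis element of s placed in multidegree a. On these
    chains the differential is that of the simplex, without monomial factors. *)
Definition piece p a s : chain := single s (p * 'X_[(a - gr s)%MM]).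

Lemma bd_piece p a s : (gr s <= a)%MM ->
  bd (piece p a s) = \sum_(v in s) sgn s v *: piece p a (s :\ v).
Proof.
move=> sa; rewrite bd_single; apply: eq_bigr => v vs; congr (_ *: single _ _).
rewrite -mulrA -mpolyXD; congr (_ * 'X_[_]).
have le_sv := gr_lcm_sub m (subD1set s v).
by rewrite addmBA // submK.
Qed.

(** Deleting u and then v, or v and then u, gives opposite terms. The terms with
    u < v are matched with those with v < u, which also settles characteristic
    two. *)
Lemma bd_bd c : bd (bd c) = 0.
Proof.
rewrite [c]chain_single !linear_sum big1 //= => s _; move: (c s) => {c} p.
rewrite (_ : single s p = piece p (gr s) s); last first.
  rewrite /piece (_ : _ - _ = 0)%MM ?mpolyX0 ?mulr1 //.
  by apply/mnmP=> i; rewrite mnmBE subnn mnm0E.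
rewrite bd_piece ?lepm_refl // linear_sum /=.
pose F v u := (sgn s v * sgn (s :\ v) u) *: piece p (gr s) (s :\ v :\ u).
have antiF u v : u \in s -> v \in s -> u != v -> F v u = - F u v.
  by move=> us vs uv; rewrite /F sgn_anti // scaleNr !setDDl setUC.
have split_bd v : v \in s -> bd (sgn s v *: piece p (gr s) (s :\ v)) =
    \sum_(u in s | (u < v)%N) F v u + \sum_(u in s | (v < u)%N) F v u.
  move=> vs; rewrite linearZ /= bd_piece ?gr_lcm_sub ?subD1set // scaler_sumr.
  rewrite (bigID (fun u : 'I_r => (u < v)%N)) /=; congr (_ + _);
  apply: eq_big => [u|u _]; rewrite ?scalerA // !inE -val_eqE /=;
  by case: ltngtP; rewrite ?andbT ?andbF.
rewrite (eq_bigr _ split_bd) big_split /=.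
rewrite [X in _ + X](exchange_big_dep (fun u => u \in s)) /=; last first.
  by move=> ? ? _ /andP[].
rewrite -big_split big1 // => v vs /=.
apply/eqP; rewrite addr_eq0 -sumrN; apply/eqP; apply: eq_big => [u|u /andP[us uv]].
  by rewrite vs.
by rewrite antiF // -val_eqE neq_ltn uv.
Qed.

(** In multidegree a only the faces whose generators all divide x^a occur. They
    form a simplex, which is contracted onto the vertex v chosen here; the vertex
    depends on a only. *)
Definition cone a s : chain :=
  if [pick i | (m i <= a)%MM] is Some v then
    if v \in s then 0 else sgn (v |: s) v *: piece 1 a (v |: s)
  else 0.

Definition homotopy c : chain :=
  \sum_s mlift (fun a => cone (a + gr s)%MM s) (c s).

Lemma homotopy_is_linear : linear homotopy.
Proof.
move=> x c b; rewrite /homotopy scaler_sumr -big_split /=.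
by apply: eq_bigr => s _; rewrite !ffunE linearP.
Qed.
HB.instance Definition _ :=
  GRing.isLinear.Build K chain chain _ homotopy homotopy_is_linear.

Lemma homotopy_piece a s : (gr s <= a)%MM -> homotopy (piece 1 a s) = cone a s.
Proof.
move=> sa; rewrite /homotopy (bigD1 s) //= big1 ?addr0.
  by rewrite ffunE eqxx mul1r mliftX submK.
by move=> t ts; rewrite ffunE (negPf ts) linear0.
Qed.

(** The contraction of a simplex onto its vertex v: if v is in s, only the term
    of the boundary without v has a nonzero cone; otherwise the boundary of the
    cone of s is s minus the cone of the boundary of s. *)
Lemma homotopy_cone a s i : (gr s <= a)%MM -> (m i <= a)%MM ->
  bd (homotopy (piece 1 a s)) + homotopy (bd (piece 1 a s)) = piece 1 a s.
Proof.
move=> sa ia; rewrite homotopy_piece // bd_piece // linear_sum /=.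
have -> : \sum_(u in s) homotopy (sgn s u *: piece 1 a (s :\ u)) =
    \sum_(u in s) sgn s u *: cone a (s :\ u).
  apply: eq_bigr => u us; rewrite linearZ /= homotopy_piece //.
  by apply: lepm_trans sa; rewrite gr_lcm_sub ?subD1set.
rewrite /cone; case: pickP => [v va|/(_ i)]; last by rewrite ia.
case: ifP => vs.
  rewrite linear0 add0r (bigD1 v) //= big1 ?addr0.
    by rewrite !inE eqxx /= setD1K // scalerA sgn2 scale1r.
  by move=> u /andP[us uv]; rewrite !inE eq_sym uv vs scaler0.
have wa : (gr (v |: s) <= a)%MM.
  rewrite lem_gr_lcm; apply/forall_inP=> j; rewrite !inE => /orP[/eqP->//|js].
  exact: lepm_trans (le_gr_lcm m js) sa.
rewrite linearZ /= bd_piece // (bigD1 v) ?setU11 //= setU1K ?vs //.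
rewrite scalerDr scalerA sgn2 scale1r -addrA scaler_sumr.
rewrite -[RHS]addr0; congr (_ + _).
rewrite [X in X + _](_ : _ =
    \sum_(u in s) (sgn (v |: s) v * sgn (v |: s) u) *: piece 1 a ((v |: s) :\ u)).
  rewrite -big_split big1 // => u us /=.
  have uv : u != v by apply: contraTneq us => ->; rewrite vs.
  have wu : v |: (s :\ u) = (v |: s) :\ u.
    by apply/setP=> w; rewrite !inE; case: eqVneq => //= ->; rewrite eq_sym uv.
  rewrite !inE eq_sym uv vs /= wu scalerA -scalerDl.
  have := @sgn_swap K r (v |: s) u v; rewrite setU1K ?vs // => -> //;
    rewrite ?inE ?eqxx ?us ?orbT //.
  by rewrite addrN scale0r.
apply: eq_big => [u|u _]; last by rewrite scalerA.
rewrite !inE; case: eqVneq => [->|_] /=; by rewrite ?vs ?andbT.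
Qed.

Lemma monomial_ideal_msupp p a : monomial_ideal m p -> a \in msupp p ->
  exists i, (m i <= a)%MM.
Proof.
case=> d ->; rewrite mcoeff_msupp => nz.
have [i mi|none] := pickP (fun i => (m i <= a)%MM); first by exists i.
case/eqP: nz; rewrite raddf_sum big1 //= => i _.
apply/eqP; rewrite -[_ == 0]negbK -mcoeff_msupp (perm_mem (msuppMX _ _)).
by apply/mapP=> -[a' _ ea]; have := none i; rewrite ea lem_addr.
Qed.

(** The multidegrees in which no generator divides x^a, where there is no cone,
    carry only the empty face. They do not occur in c, whose coefficient at the
    empty face lies in the ideal. *)
Lemma taylor_exact c : bd c = 0 -> monomial_ideal m (c set0) ->
  bd (homotopy c) = c.
Proof.
move=> c0 cI; suff : bd (homotopy c) + homotopy (bd c) = c by rewrite c0 linear0 addr0.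
have defc : c = \sum_s \sum_(a <- msupp (c s)) (c s)@_a *: piece 1 (a + gr s)%MM s.
  rewrite {1}[c]chain_single; apply: eq_bigr => s _.
  rewrite {1}[c s]mpolyE linear_sum; apply: eq_bigr => a _.
  by rewrite linearZ /= /piece mul1r addmK.
(* The homotopy is itself defined as a sum, so that linear_sum would also match
   bd (homotopy c); hence the two separate forms. *)
have hsum I l (F : I -> chain) :
    homotopy (\sum_(i <- l) F i) = \sum_(i <- l) homotopy (F i).
  exact: linear_sum.
have bsum I l (F : I -> chain) : bd (\sum_(i <- l) F i) = \sum_(i <- l) bd (F i).
  exact: linear_sum.
rewrite {1 2 3}defc hsum !bsum hsum -big_split /=; apply: eq_bigr => s _.
rewrite hsum !bsum hsum -big_split /= big_seq [RHS]big_seq; apply: eq_bigr => a as_.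
rewrite !linearZ /= -scalerDr; congr (_ *: _).
have [i mi] : exists i, (m i <= a + gr s)%MM.
  have [s0|[v vs]] := set_0Vmem s.
    by rewrite s0 gr_lcm0 addm0 in as_ *; apply: monomial_ideal_msupp as_.
  by exists v; apply: lepm_trans (le_gr_lcm m vs) (lem_addl _ _).
by apply: homotopy_cone mi; apply: lem_addl.
Qed.

(** * Collapses preserve exactness *)

(** The hypothesis on the coefficient at the empty face replaces R by R/I at the
    end of the complex; for chains in positive degree it is trivial, so that a
    single condition expresses exactness at all F_i. *)
Definition exact_on (X : {set face r}) := forall c,
  (forall s, s \notin X -> c s = 0) -> bd c = 0 -> monomial_ideal m (c set0) ->
  exists2 b : chain, forall s, s \notin X -> b s = 0 & bd b = c.

Lemma bd_free_face c v s :
  v \notin s -> (forall u, u \notin s -> u != v -> c (u |: s) = 0) ->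
  gr s = gr (v |: s) -> bd c s = sgn (v |: s) v *: c (v |: s).
Proof.
move=> vs c0 grs; rewrite bdE (bigD1 v) //= big1 ?addr0.
  rewrite -grs (_ : _ - _ = 0)%MM ?mpolyX0 ?mulr1 //.
  by apply/mnmP=> i; rewrite mnmBE subnn mnm0E.
by move=> u /andP[us uv]; rewrite c0 // mul0r scaler0.
Qed.

(** Let w = v |: s. A chain b on X with boundary c is corrected by a multiple of
    the boundary of w, whose coefficient at s is a unit because w and s have the
    same degree; this removes the coefficient of b at s. The coefficient at w
    then vanishes by itself, since w is the only coface of s and c vanishes
    at s. *)
Lemma exact_collapse (X X' : {set face r}) v s :
  simplicial_complex X -> v \notin s -> v |: s \in X -> s \in X ->
  gr s = gr (v |: s) ->
  (forall t, t \in X -> s \subset t -> t = s \/ t = v |: s) ->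
  (forall t, (t \in X') = [&& t != v |: s, t != s & t \in X]) ->
  exact_on X -> exact_on X'.
Proof.
move=> cX vs wX sX grs free X'E exX c c0 bc cI.
have subX t : t \notin X -> t \notin X' by rewrite X'E => /negPf->; rewrite !andbF.
have [|b b0 bb] := exX c _ bc cI; first by move=> t /subX/c0.
set w := v |: s in wX grs free X'E *.
pose e := single w (sgn w v *: b s).
have neu u : u \notin s -> u != v -> u |: s != w.
  move=> us uv; apply: contraNneq us => euw.
  by have := setU11 u s; rewrite euw !inE (negPf uv).
have subE (d d' : chain) t : (d - d') t = d t - d' t by rewrite !ffunE.
have supp_be t : t \notin X -> (b - bd e) t = 0.
  move=> tX; rewrite subE b0 // /e bd_single sum_ffunE big1 ?subr0 // => u _.
  rewrite !ffunE ifF ?scaler0 //; apply: contraNF tX => /eqP->.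
  exact: cX wX (subD1set _ _).
have bds (d : chain) : (forall t, t \notin X -> d t = 0) -> bd d s = sgn w v *: d w.
  move=> d0; apply: bd_free_face => // u us uv; apply: d0; apply/negP=> uX.
  case: (free _ uX (subsetUr _ _)) => euw; last by have := neu _ us uv; rewrite euw eqxx.
  by rewrite -euw setU11 in us.
have be0 : (b - bd e) s = 0.
  rewrite subE (@bd_free_face e v) // => [|u us uv].
    by rewrite ffunE eqxx scalerA sgn2 scale1r subrr.
  by rewrite ffunE (negPf (neu u us uv)).
have bbe : bd (b - bd e) = c by rewrite linearB /= bd_bd subr0.
exists (b - bd e) => // t; rewrite X'E !negb_and !negbK.
move=> /or3P[/eqP->|/eqP->//|/supp_be//].
rewrite -[LHS]scale1r -(sgn2 K w v) -scalerA -bds // bbe c0 ?scaler0 //.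
by rewrite X'E eqxx andbF.
Qed.

(** * From chains on all faces to the graded complex *)

Section Transfer.
Variable X : {set face r}.

Definition ext i (c : chains K n X i) : chain :=
  [ffun s => if insub s is Some u then c u else 0].

Definition res i (b : chain) : chains K n X i := [ffun u => b (val u)].

Lemma ext_val i (c : chains K n X i) u : ext c (val u) = c u.
Proof. by rewrite ffunE valK. Qed.

Lemma ext_out i (c : chains K n X i) s :
  ~~ ((s \in X) && (#|s| == i)) -> ext c s = 0.
Proof. by move=> sN; rewrite ffunE insubN. Qed.

Lemma ext_res i b s : (s \in X) && (#|s| == i) -> ext (res i b) s = b s.
Proof. by move=> sX; rewrite ffunE insubT ffunE. Qed.

Lemma big_ext i (F : face r -> R) (c : chains K n X i) :
  \sum_(u : faces_of_card X i) c u * F (val u) = \sum_s ext c s * F s.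
Proof.
rewrite [RHS](bigID (fun s => (s \in X) && (#|s| == i))) /=.
rewrite [X in _ + X]big1 ?addr0; last by move=> s /ext_out->; rewrite mul0r.
rewrite (big_sub (fun s => (s \in X) && (#|s| == i))) /=.
by apply: eq_bigr => u _; rewrite ext_val.
Qed.

Lemma differential_val i (c : chains K n X i.+1) u :
  differential gr c u = bd (ext c) (val u).
Proof.
rewrite [LHS]ffunE [RHS]ffunE.
exact: (big_ext (fun s => incidence K n s (val u) * 'X_[(gr s - gr (val u))%MM])).
Qed.

Lemma augmentationE (c : chains K n X 0) : augmentation c = ext c set0.
Proof.
rewrite /augmentation; under eq_bigr => u _ do rewrite -[c u]mulr1.
rewrite (big_ext (fun=> 1)) (bigD1 set0) //= big1 ?addr0 ?mulr1 // => s s0.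
by rewrite ext_out ?mul0r // cards_eq0 (negPf s0) andbF.
Qed.

Lemma bd_ext_out i (c : chains K n X i) t : (#|t|.+1 != i)%N -> bd (ext c) t = 0.
Proof.
move=> ti; rewrite bdE big1 // => u ut.
by rewrite ext_out ?mul0r ?scaler0 // cardsU1 ut (negPf ti) andbF.
Qed.

Lemma ext_differential i (c : chains K n X i.+1) : simplicial_complex X ->
  ext (differential gr c) = bd (ext c).
Proof.
move=> cX; apply/ffunP=> t.
have [/andP[tX ti]|tN] := boolP ((t \in X) && (#|t| == i)).
  have tXi : (t \in X) && (#|t| == i) by rewrite tX.
  by rewrite -[t]/(val (Sub t tXi : faces_of_card X i)) ext_val differential_val.
rewrite ext_out //; have [ti|ti] := eqVneq #|t| i; last by rewrite bd_ext_out ?eqSS.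
rewrite bdE big1 // => u ut; rewrite ext_out ?mul0r ?scaler0 // negb_and.
move: tN; rewrite ti eqxx andbT => tX; apply/orP; left; apply: contra tX => uX.
exact: cX uX (subsetUr _ _).
Qed.

Lemma bd_res i b t : (forall s, s \notin X -> b s = 0) -> #|t| = i ->
  bd (ext (res i.+1 b)) t = bd b t.
Proof.
move=> b0 ti; rewrite !bdE; apply: eq_bigr => u ut; congr (_ *: (_ * _)).
have [uX|uX] := boolP (u |: t \in X); last by rewrite b0 // ext_out // (negPf uX).
by rewrite ext_res // uX cardsU1 ut ti add1n eqxx.
Qed.

Lemma exact_differential i (c : chains K n X i) : exact_on X ->
  bd (ext c) = 0 -> monomial_ideal m (ext c set0) ->
  exists b : chains K n X i.+1, differential gr b = c.
Proof.
move=> exX bc cI; have [|b b0 bb] := exX _ _ bc cI.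
  by move=> s sX; rewrite ext_out // (negPf sX).
exists (res i.+1 b); apply/ffunP=> u; rewrite differential_val bd_res ?bb ?ext_val //.
by have /andP[_ /eqP] := valP u.
Qed.

Lemma monomial_ideal0 : monomial_ideal m (0 : R).
Proof. by exists (fun=> 0); rewrite big1 // => i _; rewrite mul0r. Qed.

Lemma bd_set0_ideal b : monomial_ideal m (bd b set0).
Proof.
exists (fun u => sgn (u |: set0) u *: b (u |: set0)).
rewrite bdE; apply: eq_big => [u|u _]; first by rewrite inE.
by rewrite setU0 gr_lcm1 gr_lcm0 subm0 scalerAl.
Qed.

(** The complex of X may be void. Then F_0 = 0, and R/I must vanish as well,
    which the last hypothesis ensures. *)
Lemma exact_supports : simplicial_complex X -> exact_on X ->
  set0 \in X \/ (exists i, m i = 0%MM) ->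
  supports_free_resolution K X gr m.
Proof.
move=> cX exX X0; split.
- move=> i c; split=> [dc|[b <-]].
    apply: exact_differential => //; last first.
      by rewrite ext_out ?cards0 ?andbF //; apply: monomial_ideal0.
    rewrite -ext_differential // dc; apply/ffunP=> s; rewrite !ffunE.
    by case: insubP => // u; rewrite ffunE.
  by apply/ffunP=> u; rewrite differential_val ext_differential // bd_bd !ffunE.
- move=> c; rewrite augmentationE; split=> [cI|[b <-]].
    apply: exact_differential => //; apply/ffunP=> t.
    by rewrite bd_ext_out // ffunE.
  by rewrite ext_differential //; apply: bd_set0_ideal.
move=> p; case: X0 => [X0|[i mi]].
  exists (res 0 (single set0 p)).
  rewrite augmentationE ext_res ?X0 ?cards0 // ffunE eqxx subrr.
  exact: monomial_ideal0.
exists (res 0 0).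
have -> : p - augmentation (res 0 0) = p * 'X_[m i].
  rewrite mi mpolyX0 mulr1 /augmentation big1 ?subr0 // => u _.
  by rewrite !ffunE.
exists (fun j => if j == i then p else 0); rewrite (bigD1 i) //= eqxx big1 ?addr0 //.
by move=> j ji; rewrite (negPf ji) mul0r.
Qed.

End Transfer.
End Taylor.

(** * The theorem *)

Lemma collapsed_exact (K : fieldType) n r (m : 'I_r -> 'X_{1..n}) A :
  collapsed (gr_lcm m) A -> exact_on K m (critical_faces A).
Proof.
elim=> [c _ bc cI|{}A v s cA exA vs wA sA grs free].
  by exists (homotopy m c) => [s|]; [rewrite critical0|exact: taylor_exact].
apply: (exact_collapse (collapsed_complex cA) vs wA sA grs free _ exA) => t.
exact: critical_collapse.
Qed.

(** The empty face is removed only together with a vertex of the same degree,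
    that is, of degree 0. *)
Lemma collapsed_set0 n r (m : 'I_r -> 'X_{1..n}) A :
  collapsed (gr_lcm m) A ->
  set0 \in critical_faces A \/ exists i, m i = 0%MM.
Proof.
elim=> [|{}A v s cA [A0|m0] vs wA sA grs free]; [left; exact: critical0| |by right].
have [s0|s0] := eqVneq s set0.
  right; exists v; apply/mnmP=> i; apply/eqP; rewrite mnm0E -leqn0 -(mnm0E i).
  apply: (mnm_lepP _); rewrite -(gr_lcm0 m) -s0 grs.
  by apply: le_gr_lcm; rewrite setU11.
left; rewrite critical_collapse A0 andbT eq_sym [set0 == s]eq_sym s0 andbT.
by apply/set0Pn; exists v; rewrite setU11.
Qed.

Theorem mainTheorem2 (K : fieldType) (n r : nat) (m : 'I_r -> 'X_{1..n}) :
  let gr := gr_lcm m in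
  let A_S := simplicial_pruning gr in
  let X_AS := critical_faces A_S in
  (forall j : 'I_r,
     homogeneous_acyclic_matching gr (prune_step gr (pruned_upto gr j) j)) /\
  (forall k : nat, (k <= r)%N ->
     homogeneous_acyclic_matching gr (pruned_upto gr k)) /\
  simplicial_complex X_AS /\
  supports_free_resolution K X_AS gr m.
Proof.
move=> gr A_S X_AS.
have cA k : collapsed gr (pruned_upto gr k) by apply: collapsed_pruned_upto.
split=> [j|]; last split=> [k _|]; last split.
- by apply: (collapsed_sub (cA j.+1)); rewrite pruned_uptoS subsetUr.
- exact: collapsed_sub (cA k) (subxx _).
- exact: collapsed_complex (cA r).
apply: exact_supports.
- exact: collapsed_complex (cA r).
- exact: collapsed_exact (cA r).
exact: collapsed_set0 (cA r).
Qed.
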